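(* Let $0\le\ell<u$, $n\ge2$, $p>1$ with $p\ne2$. Starting from the initial point $$x^0=\left(\ell+\tfrac{u-\ell}{n},\ldots,\ell+\tfrac{i(u-\ell)}{n},\ldots,\ell+\tfrac{(n-1)(u-\ell)}{n}\right)^\top\in\mathbb{R}^{n-1},$$ construct the Newton's-method sequence $\{x^k\}$ by iterating $$x^{k+1}:=x^k-[F'(x^k)]^{-1}F(x^k).$$ Then $\{x^k\}$ is monotonically decreasing to $x^*$ when $1<p<2$, and monotonically increasing to $x^*$ when $p>2$, where $x^*$ satisfies $F(x^* )=0$.
   Context: For $x=(\xi_1,\ldots,\xi_{n-1})^\top$ with $\ell<\xi_1<\cdots<\xi_{n-1}<u$, and with $\xi_0:=\ell$, $\xi_n:=u$, $F(x):=[F_1(x),\ldots,F_{n-1}(x)]^\top$ where, for $i=1,\ldots,n-1$, $$F_i(x):=-\frac{\xi_i^p+(p-1)\xi_{i+1}^p-p\,\xi_i\xi_{i+1}^{p-1}}{\xi_{i+1}^{p-1}-\xi_i^{p-1}}+\frac{\xi_i^p+(p-1)\xi_{i-1}^p-p\,\xi_i\xi_{i-1}^{p-1}}{\xi_i^{p-1}-\xi_{i-1}^{p-1}}.$$ $F'$ is the $(n-1)\times(n-1)$ Jacobian matrix $\left[\partial F_i/\partial\xi_j\right]$. Monotonicity of a sequence of vectors is understood componentwise. *)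

(* Defs.v *)
From mathcomp Require Import all_boot all_order all_algebra.
From mathcomp Require Import all_classical all_reals all_analysis.
Import Order.TTheory GRing.Theory Num.Theory.
Import numFieldNormedType.Exports.

Set Implicit Arguments.
Unset Strict Implicit.
Unset Printing Implicit Defensive.

Local Open Scope classical_set_scope.
Local Open Scope ring_scope.

Section Newton.
Variables (R : realType) (l u p : R) (n : nat).

(* The vector x : 'cV_n.-1 stores xi_1, ..., xi_(n-1) at positions
   0, ..., n-2; [knot x k] is xi_k, with xi_0 = l and xi_k = u for k >= n. *)
Definition knot (x : 'cV[R]_n.-1) (k : nat) : R :=
  if k is j.+1 then oapp (fun i : 'I_n.-1 => x i 0) u (insub j) else l.

Definition ordered_knots (x : 'cV[R]_n.-1) : Prop :=
  forall k : nat, (k < n)%N -> knot x k < knot x k.+1.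

(* a is xi_i and b is one of its two neighbours; `^ is the real power, with
   0 `^ q = 0 for q != 0. *)
Definition Fterm (a b : R) : R :=
  a `^ p + (p - 1) * b `^ p - p * a * b `^ (p - 1).

Definition F (x : 'cV[R]_n.-1) : 'cV[R]_n.-1 :=
  \col_(i < n.-1)
    let prev := knot x i in
    let cur := knot x i.+1 in
    let next := knot x i.+2 in
    - (Fterm cur next / (next `^ (p - 1) - cur `^ (p - 1)))
    + Fterm cur prev / (cur `^ (p - 1) - prev `^ (p - 1)).

(* The library's [jacobian] acts on row vectors and is the transpose of
   this matrix. *)
Definition F' (x : 'cV[R]_n.-1) : 'M[R]_n.-1 :=
  \matrix_(i < n.-1, j < n.-1)
    ('D_(delta_mx j 0) (fun y : 'cV[R]_n.-1 => F y i 0 : R^o) x : R).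

Definition newton_init : 'cV[R]_n.-1 :=
  \col_(i < n.-1) (l + i.+1%:R * (u - l) / n%:R).

Definition newton_step (x : 'cV[R]_n.-1) : 'cV[R]_n.-1 :=
  x - invmx (F' x) *m F x.

Definition newton (k : nat) : 'cV[R]_n.-1 := iter k newton_step newton_init.

End Newton.

(* Main.v *)
Require Import Defs.
From mathcomp Require Import all_boot all_order all_algebra.
From mathcomp Require Import all_classical all_reals all_analysis.
From mathcomp Require Import ring lra.
Import Order.TTheory GRing.Theory Num.Theory.
Import numFieldNormedType.Exports.

Local Open Scope classical_set_scope.
Local Open Scope ring_scope.

Set Implicit Arguments.
Unset Strict Implicit.
Unset Printing Implicit Defensive.

(** The quotient [Fterm a b / (b^(p-1) - a^(p-1))] is, up to the factor [p],
    the signed distance from [a] to the point [centroid a b] where the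
    tangents of [t^p] at [a] and [b] meet; that point is also the barycentre
    of [[a, b]] for the density [t^(p-2)]. Hence
    [F_i = p (2 xi_i - c(xi_(i-1), xi_i) - c(xi_i, xi_(i+1)))], where [c] is
    the centroid. The centroid is
    homogeneous of degree one, increasing in both arguments, concave when
    [p < 2] and convex when [p > 2]; multiplying by [2 - p] lets both cases be
    treated together.

    Four facts on the centroid carry the proof: Euler's identity
    [a c_a + b c_b = c] ([centroid_euler]); the tangent inequality
    ([centroid_tangent]), which says that [(2 - p) c] is concave; the sign
    of [(2 - p) (c_a + c_b - 1)] ([centroid_lDr]); and the comparisons with
    two linear means ([centroid_mid], [centroid_chord]). Concavity reduces,
    after normalising [a = 1], to the sign of one explicit function
    ([centroid_defect_sign]), and that function also governs [centroid_mid].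

    By Euler's identity the Newton equation becomes homogeneous: the new
    knots [Y], boundary values included, satisfy the three-term recurrence
    [2 Y_i = al_(i-1) Y_(i-1) + be_(i-1) Y_i + al_i Y_i + be_i Y_(i+1)]
    whose positive coefficients are the partial derivatives at the old knots
    ([newton_step_row]). Such a recurrence obeys a maximum principle
    ([tridiag_ge0]) as soon as it has a positive supersolution: the old
    knots when [p < 2], provided that [F >= 0] there, and the constant 1
    when [p > 2]. The maximum principle gives the invertibility of the
    Jacobian matrix, the direction in which the knots move, and [Y >= 0].
    The recurrence rewritten for the differences [Y_(i+1) - Y_i] then
    propagates their positivity, from the right end when [p < 2] and from
    the left end when [p > 2], so the new knots are ordered. Finally the
    tangent inequality gives [(2 - p) F(Y) >= 0], so that the pair formed by
    the ordering and this sign is invariant under a Newton step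
    ([newton_step_signed]); it holds at the uniform grid because there the
    midpoint comparison adds up.

    The iterates are thus monotone and bounded. The chord comparison turns
    [(2 - p) F >= 0] into [(2 - p) (d_i - (p - 1) d_(i+1)) >= 0] for the
    gaps [d_i = xi_i - xi_(i-1)], a closed condition that keeps the knots of
    the limit distinct; the recurrence then passes to the limit and says
    that [F] vanishes there. *)

(** * The centroid and its partial derivatives *)

Section Centroid.
Context {R : realType} (p : R).
Hypothesis hp : 1 < p.

(** The abscissa where the tangents of [t^p] at [a] and [b] meet, and the
    barycentre of [[a, b]] for the density [t^(p-2)]. *)
Definition centroid (a b : R) : R :=
  (p - 1) / p * ((b `^ p - a `^ p) / (b `^ (p - 1) - a `^ (p - 1))).

(** The partial derivative of [centroid] in [a] for [a > 0]. At [a = 0] the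
    centroid need not be differentiable in [a]; the value [1/p] keeps
    [centroid_l] positive and makes it add up to 1 with [centroid_r] there.
    Euler's identity multiplies it by [a = 0], and the Jacobian matrix by
    the zero variation of the fixed end knot. *)
Definition centroid_l (a b : R) : R :=
  if a == 0 then p^-1
  else (p - 1) * a `^ (p - 2) * (centroid a b - a)
    / (b `^ (p - 1) - a `^ (p - 1)).

(** The partial derivative of [centroid] in [b]. *)
Definition centroid_r (a b : R) : R :=
  (p - 1) * b `^ (p - 2) * (b - centroid a b) / (b `^ (p - 1) - a `^ (p - 1)).

Lemma powR_succ (a : R) : 0 <= a -> a `^ p = a * a `^ (p - 1).
Proof. by move=> a0; rewrite mulr_powRB1// (lt_trans ltr01). Qed.

Lemma powR_pred (a : R) : 0 < a -> a `^ (p - 2) = a `^ (p - 1) / a.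
Proof.
move=> a0; rewrite (_ : p - 2 = p - 1 - 1); last by ring.
have an : a != 0 by rewrite gt_eqF.
by rewrite (@powRB _ a (p - 1) 1) ?an ?implybT// powRr1// ltW.
Qed.

Lemma powR_div (a b r : R) : 0 <= a -> 0 < b ->
  (a / b) `^ r = a `^ r / b `^ r.
Proof.
move=> a0 b0; have br : b `^ r != 0 by rewrite gt_eqF// powR_gt0.
apply: (mulIf br); rewrite -mulrA mulVf// mulr1 -powRM ?divr_ge0// ?ltW//.
by rewrite -mulrA mulVf ?mulr1// gt_eqF.
Qed.

Lemma powR_exp (x r : R) : 0 < x -> x `^ r = expR (r * ln x).
Proof. by move=> x0; rewrite /powR gt_eqF. Qed.

Lemma powR_diff_gt0 (a b : R) : 0 <= a -> a < b ->
  0 < b `^ (p - 1) - a `^ (p - 1).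
Proof.
move=> a0 ab; rewrite subr_gt0; apply: gt0_ltr_powR => //.
- by rewrite subr_gt0.
- by rewrite nnegrE (le_trans a0)// ltW.
Qed.

(** [Fterm] is the gap between the strictly convex function [t^p] and its
    tangent at [b]. For positive [a] and [b], with [d = ln (a / b)], it is
    [a b^(p-1)] times [exp ((p-1) d) + (p-1) exp (- d) - p], which is
    positive because [exp s > 1 + s] for nonzero [s]. *)
Lemma Fterm_gt0 (a b : R) : 0 <= a -> 0 <= b -> a != b -> 0 < Fterm p a b.
Proof.
move=> a0 b0 nab; rewrite /Fterm.
have p0 : p != 0 by rewrite gt_eqF// (lt_trans ltr01).
have q0 : p - 1 != 0 by rewrite subr_eq0 gt_eqF.
case: (eqVneq a 0) nab => [->|an] nab.
  rewrite powR0// mulr0 mul0r subr0 add0r mulr_gt0 ?subr_gt0// powR_gt0//.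
  by rewrite lt0r b0 andbT eq_sym.
have {an} ap : 0 < a by rewrite lt0r an.
case: (eqVneq b 0) nab => [->|bn] nab.
  by rewrite !powR0// !mulr0 subr0 addr0 powR_gt0.
have {bn} bp : 0 < b by rewrite lt0r bn.
have ln_ne : ln a - ln b != 0.
  by rewrite subr_eq0; apply: contra nab => /eqP/ln_inj ->; rewrite ?posrE.
set d := ln a - ln b in ln_ne.
have h1 : 1 + (p - 1) * d < expR ((p - 1) * d).
  by rewrite expR_gt1Dx// mulf_neq0.
have h2 : 1 - d <= expR (- d) by rewrite expR_ge1Dx.
have ea : a * b `^ (p - 1) = expR (ln a + (p - 1) * ln b).
  by rewrite expRD lnK ?posrE// powR_exp.
have -> : a `^ p + (p - 1) * b `^ p - p * a * b `^ (p - 1) =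
  (expR ((p - 1) * d) + (p - 1) * expR (- d) - p) * (a * b `^ (p - 1)).
  have -> : a `^ p = expR ((p - 1) * d) * (a * b `^ (p - 1)).
    rewrite ea powR_exp// -expRD; congr expR; rewrite /d; ring.
  have -> : b `^ p = expR (- d) * (a * b `^ (p - 1)).
    rewrite ea powR_exp// -expRD; congr expR; rewrite /d; ring.
  ring.
rewrite mulr_gt0// ?mulr_gt0 ?powR_gt0// subr_gt0.
have : (p - 1) * (1 - d) <= (p - 1) * expR (- d) by rewrite ler_pM2l// subr_gt0.
lra.
Qed.

Lemma FtermE_l (a b : R) : 0 <= a -> a `^ (p - 1) != b `^ (p - 1) ->
  Fterm p a b / (b `^ (p - 1) - a `^ (p - 1)) = p * (centroid a b - a).
Proof.
move=> a0 h; rewrite /Fterm /centroid (powR_succ a0); field.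
have p0 : p != 0 by rewrite gt_eqF// (lt_trans ltr01).
by rewrite p0 subr_eq0 eq_sym h.
Qed.

Lemma FtermE_r (a b : R) : 0 <= b -> a `^ (p - 1) != b `^ (p - 1) ->
  Fterm p b a / (b `^ (p - 1) - a `^ (p - 1)) = p * (b - centroid a b).
Proof.
move=> a0 h; rewrite /Fterm /centroid (powR_succ a0); field.
have p0 : p != 0 by rewrite gt_eqF// (lt_trans ltr01).
by rewrite p0 subr_eq0 eq_sym h.
Qed.

Lemma powR_neq (a b : R) : 0 <= a -> a < b -> a `^ (p - 1) != b `^ (p - 1).
Proof.
by move=> a0 ab; rewrite eq_sym -subr_eq0 gt_eqF// powR_diff_gt0.
Qed.

Lemma centroid_gt (a b : R) : 0 <= a -> a < b -> a < centroid a b.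
Proof.
move=> a0 ab; have p0 : 0 < p by rewrite (lt_trans ltr01).
rewrite -subr_gt0 -(pmulr_rgt0 _ p0) -FtermE_l ?powR_neq//.
rewrite divr_gt0 ?powR_diff_gt0// Fterm_gt0 ?lt_eqF//.
by rewrite (le_trans a0)// ltW.
Qed.

Lemma centroid_lt (a b : R) : 0 <= a -> a < b -> centroid a b < b.
Proof.
move=> a0 ab; have p0 : 0 < p by rewrite (lt_trans ltr01).
have b0 : 0 <= b by rewrite (le_trans a0)// ltW.
rewrite -subr_gt0 -(pmulr_rgt0 _ p0) -FtermE_r ?powR_neq//.
by rewrite divr_gt0 ?powR_diff_gt0// Fterm_gt0 ?gt_eqF.
Qed.

Lemma centroid_l_gt0 (a b : R) : 0 <= a -> a < b -> 0 < centroid_l a b.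
Proof.
move=> a0 ab; rewrite /centroid_l; case: eqVneq => [_|an].
  by rewrite invr_gt0 (lt_trans ltr01).
rewrite divr_gt0 ?powR_diff_gt0// mulr_gt0 ?subr_gt0 ?centroid_gt//.
by rewrite mulr_gt0 ?subr_gt0// powR_gt0// lt0r an.
Qed.

Lemma centroid_r_gt0 (a b : R) : 0 <= a -> a < b -> 0 < centroid_r a b.
Proof.
move=> a0 ab; rewrite /centroid_r.
rewrite divr_gt0 ?powR_diff_gt0// mulr_gt0 ?subr_gt0 ?centroid_lt//.
by rewrite mulr_gt0 ?subr_gt0// powR_gt0// (le_lt_trans a0).
Qed.

(** Euler's identity for a function homogeneous of degree one. *)
Lemma centroid_euler (a b : R) : 0 <= a -> a < b ->
  a * centroid_l a b + b * centroid_r a b = centroid a b.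
Proof.
move=> a0 ab; have p0 : p != 0 by rewrite gt_eqF// (lt_trans ltr01).
have b0 : 0 < b by rewrite (le_lt_trans a0).
have q0 : p - 1 != 0 by rewrite subr_eq0 gt_eqF.
have := powR_diff_gt0 a0 ab => /gt_eqF.
rewrite /centroid_l /centroid_r /centroid.
rewrite (powR_pred b0)//.
case: (eqVneq a 0) => [->|an].
  rewrite !powR0// powR_succ ?ltW// !subr0 => D; field.
  by rewrite p0 D (gt_eqF b0).
have ap : 0 < a by rewrite lt0r an.
rewrite (powR_pred ap)// !powR_succ ?ltW// => D; field.
by rewrite D p0 an (gt_eqF b0).
Qed.

End Centroid.

(** * Differential calculus on the centroid *)

Lemma mean_value {R : realType} (f df : R -> R) (a b : R) : a <= b ->
  (forall x : R, x \in `[a, b]%R -> is_derive x 1 f (df x)) ->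
  exists2 c : R, c \in `[a, b]%R & f b - f a = df c * (b - a).
Proof.
move=> ab fdf; apply (MVT_segment ab).
  move=> x; rewrite in_itv/= => /andP[ax xb].
  by apply: fdf; rewrite in_itv/= !ltW.
apply: derivable_within_continuous => x xab.
exact: (@ex_derive _ _ _ _ _ _ _ (fdf x xab)).
Qed.

Section PointwiseDerivatives.
Context {R : realType}.

Lemma is_derive_const (c x : R) : is_derive x 1 (fun _ : R => c) 0.
Proof. exact: is_derive_cst. Qed.

Lemma is_derive_congr (f : R -> R) (x df df' : R) :
  is_derive x 1 f df -> df = df' -> is_derive x 1 f df'.
Proof. by move=> ? <-. Qed.

Lemma is_derive_var (x : R) : is_derive x 1 (fun y : R => y) 1.
Proof. exact: is_derive_id. Qed.

Variables (f g : R -> R) (x df dg : R).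
Hypotheses (fdf : is_derive x 1 f df) (gdg : is_derive x 1 g dg).

Lemma is_derive_sub : is_derive x 1 (fun y => f y - g y) (df - dg).
Proof. exact: is_deriveB. Qed.

Lemma is_derive_mul : is_derive x 1 (fun y => f y * g y) (f x * dg + g x * df).
Proof. exact: is_deriveM. Qed.

Lemma is_derive_mull (c : R) : is_derive x 1 (fun y => c * f y) (c * df).
Proof. exact: is_deriveZ. Qed.

Lemma is_derive_div : g x != 0 ->
  is_derive x 1 (fun y => f y / g y) ((df * g x - f x * dg) / (g x * g x)).
Proof.
move=> gx0; have dV := is_deriveV gx0 gdg.
have := @is_deriveM _ _ f (fun y => (g y)^-1) x 1 _ _ fdf dV.
rewrite (_ : _ *: _ + _ = (df * g x - f x * dg) / (g x * g x)) //.
by rewrite /GRing.scale/=; field.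
Qed.

End PointwiseDerivatives.

(** * Concavity or convexity of the centroid *)

Section Tangent.
Context {R : realType} (p : R).
Hypothesis hp : 1 < p.

(** With [t = exp y] this only uses [1 + s <= exp s]: for [p <= 2] applied
    to both powers, for [p > 2] after division by [t^(p-2)]. *)
Lemma bernoulli_powR (t : R) : 0 < t ->
  0 <= (2 - p) * ((2 - p) * t `^ (p - 1) + (p - 1) * t `^ (p - 2) - 1).
Proof.
move=> t0; rewrite !powR_exp//; set y := ln t.
have [p2|p2] := leP p 2.
  rewrite mulr_ge0 ?subr_ge0//.
  have h1 : (2 - p) * (1 + (p - 1) * y) <= (2 - p) * expR ((p - 1) * y).
    by rewrite ler_wpM2l ?subr_ge0 ?expR_ge1Dx.
  have h2 : (p - 1) * (1 + (p - 2) * y) <= (p - 1) * expR ((p - 2) * y).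
    by rewrite ler_wpM2l ?subr_ge0 ?(ltW hp) ?expR_ge1Dx.
  lra.
rewrite -mulrNN mulr_ge0// ?oppr_ge0 ?subr_le0 ?(ltW p2)//.
have -> : (p - 1) * y = (p - 2) * y + y by ring.
rewrite expRD; set E := expR ((p - 2) * y).
have E0 : 0 < E by rewrite expR_gt0.
have h1 : 1 - (p - 2) * y <= E^-1.
  by rewrite /E -expRN expR_ge1Dx.
have h2 : (p - 2) * (1 + y) <= (p - 2) * expR y.
  by rewrite ler_wpM2l ?expR_ge1Dx// subr_ge0 ltW.
have h3 : 0 <= E * (E^-1 + (p - 2) * expR y - (p - 1)).
  rewrite mulr_ge0 ?(ltW E0)//; lra.
move: h3; rewrite !mulrDr mulfV ?gt_eqF//; lra.
Qed.

(** For [t > 1], up to positive factors, this is both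
    [(1 + t) / 2 - centroid 1 t] and minus the derivative of [centroid_r 1] at [t];
    see [centroid_mid] and [is_derive_centroid_r]. *)
Definition centroid_defect (t : R) :=
  (2 - p) * (t `^ p - 1) - p * (t - t `^ (p - 1)).

(** It vanishes at 1 and its derivative is [p] times the expression of
    [bernoulli_powR]. *)
Lemma centroid_defect_sign (t : R) : 1 <= t -> 0 <= (2 - p) * centroid_defect t.
Proof.
move=> t1.
pose dk (x : R) := p * ((2 - p) * x `^ (p - 1) + (p - 1) * x `^ (p - 2) - 1).
have ddef x : x \in `[1, t]%R -> is_derive x 1 centroid_defect (dk x).
  rewrite in_itv/= => /andP[x1 _].
  have x0 : 0 < x by rewrite (lt_le_trans ltr01).
  have d1 := is_derive1_powR p x0; have d2 := is_derive1_powR (p - 1) x0.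
  have d3 := is_derive_sub d1 (is_derive_const 1 x).
  have d4 := is_derive_sub (is_derive_var x) d2.
  have := is_derive_sub (is_derive_mull d3 (2 - p)) (is_derive_mull d4 p).
  move=> /is_derive_congr; apply.
  rewrite /dk (_ : p - 1 - 1 = p - 2); last by ring.
  ring.
have [c] := mean_value t1 ddef.
rewrite in_itv/= => /andP[c1 _].
rewrite {2}/centroid_defect !powR1 !subrr !mulr0 !subrr subr0 => ->.
rewrite mulrA mulr_ge0 ?subr_ge0// /dk mulrCA.
rewrite mulr_ge0 ?(ltW (lt_trans ltr01 hp))//.
by apply: bernoulli_powR; rewrite (lt_le_trans ltr01).
Qed.

Lemma is_derive_powR_comp (f : R -> R) (x df r : R) : r != 0 ->
  0 < f x \/ f = cst 0 -> is_derive x 1 f df ->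
  is_derive x 1 (fun h => f h `^ r) (r * f x `^ (r - 1) * df).
Proof.
move=> r0 [fx fdf|-> fdf].
  have d := is_derive1_powR r fx.
  exact: (@is_derive1_comp _ (fun y => y `^ r) f x _ _ d fdf).
have -> : df = 0 by have [_ <-] := fdf; rewrite derive_cst.
rewrite mulr0 (_ : (fun _ => _) = cst 0); first exact: is_derive_const.
by apply/funext => h /=; rewrite powR0.
Qed.

(** The alternative [f = cst 0] is the case of the end knot [xi_0 = l = 0]:
    powers need not be differentiable at 0, but this knot does not move. *)
Lemma is_derive_centroid (f g : R -> R) (x df dg : R) :
  0 <= f x -> f x < g x -> 0 < f x \/ f = cst 0 ->
  is_derive x 1 f df -> is_derive x 1 g dg ->
  is_derive x 1 (fun h => centroid p (f h) (g h))
    (df * centroid_l p (f x) (g x) + dg * centroid_r p (f x) (g x)).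
Proof.
move=> f0 fg f0c fdf gdg.
have g0 : 0 < g x by rewrite (le_lt_trans f0).
have p0 : p != 0 by rewrite gt_eqF// (lt_trans ltr01).
have q0 : p - 1 != 0 by rewrite subr_eq0 gt_eqF.
have gp0 : 0 < g x \/ g = cst 0 by left.
have d1 := is_derive_powR_comp p0 f0c fdf.
have d2 := is_derive_powR_comp q0 f0c fdf.
have d3 := is_derive_powR_comp p0 gp0 gdg.
have d4 := is_derive_powR_comp q0 gp0 gdg.
have D := gt_eqF (powR_diff_gt0 hp f0 fg).
have := is_derive_mull (is_derive_div (is_derive_sub d3 d1)
  (is_derive_sub d4 d2) (negbT D)) ((p - 1) / p).
move=> /is_derive_congr; apply; rewrite (_ : p - 1 - 1 = p - 2); last by ring.
rewrite /centroid_l; case: (eqVneq (f x) 0) f0c => [fx0|fxn0] f0c.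
  have -> : df = 0.
    case: f0c => [|fE]; first by rewrite fx0 ltxx.
    by have [_ <-] := fdf; rewrite fE derive_cst.
  rewrite /centroid_r /centroid fx0 (powR0 p0) (powR0 q0) in D *.
  rewrite !(powR_succ hp) ?(ltW g0)// powR_pred//.
  rewrite subr0 in D *; field.
  by rewrite p0 D (gt_eqF g0).
have fp : 0 < f x by rewrite lt0r fxn0.
rewrite /centroid_r /centroid !(powR_succ hp) ?(ltW g0)// !powR_pred//; field.
by rewrite p0 D (gt_eqF g0).
Qed.

Lemma is_derive_centroid_r (t : R) : 1 < t ->
  is_derive t 1 (centroid_r p 1)
    (- ((p - 1) ^+ 2 / p * t `^ (p - 1) / t ^+ 2 / (t `^ (p - 1) - 1) ^+ 3
        * centroid_defect t)).
Proof.
move=> t1; have t0 : 0 < t by rewrite (lt_trans ltr01).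
have p0 : p != 0 by rewrite gt_eqF// (lt_trans ltr01).
have dg : is_derive t 1 (centroid p 1) (centroid_r p 1 t).
  have := @is_derive_centroid (fun _ => 1) (fun y => y) t 0 1 ler01 t1
    (or_introl ltr01) (is_derive_const _ _) (is_derive_var _).
  by move=> /is_derive_congr; apply; rewrite mul0r mul1r add0r.
have D := gt_eqF (powR_diff_gt0 hp ler01 t1).
have d1 := is_derive1_powR (p - 2) t0; have d2 := is_derive1_powR (p - 1) t0.
have d3 := is_derive_mul (is_derive_mull d1 (p - 1))
  (is_derive_sub (is_derive_var t) dg).
have d4 := is_derive_sub d2 (is_derive_const (1 `^ (p - 1)) t).
have := is_derive_div d3 d4 (negbT D); move=> /is_derive_congr; apply.
rewrite (_ : p - 1 - 1 = p - 2); last by ring.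
have -> : t `^ (p - 2 - 1) = t `^ (p - 1) / t ^+ 2.
  have tn : t != 0 by rewrite gt_eqF.
  rewrite (@powRB _ t (p - 2) 1) ?tn ?implybT// powRr1 ?ltW// powR_pred//.
  by rewrite expr2 invfM mulrA.
rewrite /centroid_r /centroid /centroid_defect powR_pred// !powR1.
rewrite !(powR_succ hp) ?(ltW t0)//.
move: D; rewrite powR1 => D; rewrite !expr2; field.
by rewrite p0 D (gt_eqF t0).
Qed.
Lemma centroid_norm (a b : R) : 0 < a -> a < b ->
  centroid p a b = a * centroid p 1 (b / a).
Proof.
move=> a0 ab; have b0 : 0 < b by rewrite (lt_trans a0).
have p0 : p != 0 by rewrite gt_eqF// (lt_trans ltr01).
have D := gt_eqF (powR_diff_gt0 hp (ltW a0) ab).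
rewrite /centroid !powR_div ?ltW// !powR1 !(powR_succ hp) ?ltW//; field.
by rewrite mulN1r p0 D (gt_eqF a0) gt_eqF ?powR_gt0.
Qed.

Lemma centroid_r_norm (a b : R) : 0 < a -> a < b ->
  centroid_r p a b = centroid_r p 1 (b / a).
Proof.
move=> a0 ab; have b0 : 0 < b by rewrite (lt_trans a0).
have D := gt_eqF (powR_diff_gt0 hp (ltW a0) ab).
rewrite /centroid_r (centroid_norm a0 ab) !powR_pred ?divr_gt0//.
rewrite !powR_div ?(ltW a0) ?(ltW b0)// !powR1; field.
by rewrite mulN1r D (gt_eqF a0) (gt_eqF b0) gt_eqF ?powR_gt0.
Qed.

Lemma centroid_r0 (b : R) : 0 < b -> centroid_r p 0 b = (p - 1) / p.
Proof.
move=> b0.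
have p0 : p != 0 by rewrite gt_eqF// (lt_trans ltr01).
have q0 : p - 1 != 0 by rewrite subr_eq0 gt_eqF.
rewrite /centroid_r /centroid (powR0 p0) (powR0 q0) !subr0 powR_pred//.
rewrite (powR_succ hp) ?ltW//; field.
by rewrite p0 (gt_eqF b0) gt_eqF ?powR_gt0.
Qed.

Lemma centroid0 (b : R) : 0 < b -> centroid p 0 b = (p - 1) / p * b.
Proof.
by move=> b0; rewrite -(centroid_euler hp)// mul0r add0r centroid_r0// mulrC.
Qed.

Lemma centroid_r_mono (x y : R) : 1 < x -> x <= y ->
  0 <= (2 - p) * (centroid_r p 1 x - centroid_r p 1 y).
Proof.
move=> x1 xy; pose dr (t : R) :=
  - ((p - 1) ^+ 2 / p * t `^ (p - 1) / t ^+ 2 / (t `^ (p - 1) - 1) ^+ 3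
      * centroid_defect t).
have der (t : R) : t \in `[x, y]%R -> is_derive t 1 (centroid_r p 1) (dr t).
  rewrite in_itv/= => /andP[xt _].
  by apply: is_derive_centroid_r; apply: lt_le_trans xt.
have [c] := mean_value xy der; rewrite in_itv/= => /andP[xc _] E.
have c1 : 1 < c by apply: lt_le_trans xc.
have c0 : 0 < c by rewrite (lt_trans ltr01).
rewrite -(opprB (centroid_r p 1 y)) E mulrN -mulNr mulrA.
rewrite mulr_ge0 ?subr_ge0// mulNr -mulrN /dr opprK.
rewrite mulrCA mulr_ge0 ?centroid_defect_sign ?ltW//.
have D := powR_diff_gt0 hp ler01 c1; rewrite powR1 in D.
have p0 : 0 < p by rewrite (lt_trans ltr01).
rewrite subr_gt0 in D.
by rewrite !mulr_gt0 ?invr_gt0 ?exprn_gt0 ?powR_gt0 ?subr_gt0.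
Qed.

(** The tangent plane of the concave function [(2 - p) centroid] at [(a, b)]
    lies above its graph; it passes through the origin by Euler's identity.
    By homogeneity the claim is about [centroid 1], where the mean value
    theorem compares the slope [centroid_r 1] at two points. *)
Lemma centroid_tangent (a b a' b' : R) :
  0 <= a -> a < b -> 0 <= a' -> a' < b' -> (a == 0) = (a' == 0) ->
  0 <= (2 - p) *
    (a' * centroid_l p a b + b' * centroid_r p a b - centroid p a' b').
Proof.
move=> a0 ab a'0 a'b'; case: (eqVneq a 0) a0 ab => [->|an] a0 ab.
  move=> /esym/eqP a'E; rewrite a'E in a'0 a'b' *.
  by rewrite mul0r add0r centroid_r0// centroid0// (mulrC b') subrr mulr0.
move=> /esym/negbT a'n.
have {an} ap : 0 < a by rewrite lt0r an.
have {a'n} a'p : 0 < a' by rewrite lt0r a'n.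
set t0 := b / a; set t := b' / a'.
have t01 : 1 < t0 by rewrite ltr_pdivlMr// mul1r.
have t1 : 1 < t by rewrite ltr_pdivlMr// mul1r.
set B := centroid_r p 1 t0.
have -> : a' * centroid_l p a b + b' * centroid_r p a b - centroid p a' b' =
  a' * (centroid p 1 t0 - centroid p 1 t - B * (t0 - t)).
  have := centroid_euler hp a0 ab.
  rewrite (centroid_r_norm ap ab) (centroid_norm ap ab).
  rewrite (centroid_norm a'p a'b') -/t0 -/t -/B => E.
  have -> : centroid_l p a b = centroid p 1 t0 - t0 * B.
    apply: (mulfI (lt0r_neq0 ap)); rewrite mulrBr -E /t0; field.
    by rewrite gt_eqF.
  rewrite /t; field; by rewrite gt_eqF.
rewrite mulrCA mulr_ge0//.
have der (s : R) : 1 < s -> is_derive s 1 (centroid p 1) (centroid_r p 1 s).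
  move=> s1.
  have := @is_derive_centroid (fun _ => 1) (fun y => y) s 0 1 ler01 s1
    (or_introl ltr01) (is_derive_const _ _) (is_derive_var _).
  by move=> /is_derive_congr; apply; rewrite mul0r mul1r add0r.
have [tt|/ltW tt] := leP t0 t.
- have [|c] := @mean_value R (centroid p 1) (centroid_r p 1) _ _ tt.
    by move=> x; rewrite in_itv/= => /andP[h _]; apply/der/(lt_le_trans t01).
  rewrite in_itv/= => /andP[h _] E.
  have -> : centroid p 1 t0 - centroid p 1 t - B * (t0 - t) =
    (B - centroid_r p 1 c) * (t - t0).
    by rewrite -(opprB (centroid p 1 t)) E; ring.
  by rewrite mulrA mulr_ge0 ?subr_ge0// centroid_r_mono.
- have [|c] := @mean_value R (centroid p 1) (centroid_r p 1) _ _ tt.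
    by move=> x; rewrite in_itv/= => /andP[h _]; apply/der/(lt_le_trans t1).
  rewrite in_itv/= => /andP[h h'] E.
  rewrite E -mulrBl mulrA mulr_ge0 ?subr_ge0//.
  by rewrite centroid_r_mono// (lt_le_trans t1).
Qed.

(** Apply the tangent inequality at [(1, 1 + e)]: the centroid there is
    between [1] and [1 + e], which contradicts the wrong sign when [e] is
    the absolute value of [c_a + c_b - 1]. *)
Lemma centroid_lDr (a b : R) : 0 <= a -> a < b ->
  0 <= (2 - p) * (centroid_l p a b + centroid_r p a b - 1).
Proof.
move=> a0 ab; have A0 := centroid_l_gt0 hp a0 ab.
have B0 := centroid_r_gt0 hp a0 ab.
have p0 : p != 0 by rewrite gt_eqF// (lt_trans ltr01).
case: (eqVneq a 0) => [aE|an].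
  rewrite aE /centroid_l eqxx centroid_r0; last by rewrite -aE.
  by rewrite (_ : _ - 1 = 0) ?mulr0//; field.
have tg e : 0 < e -> 0 <= (2 - p) * (centroid_l p a b +
    (1 + e) * centroid_r p a b - centroid p 1 (1 + e)).
  move=> e0; rewrite -[centroid_l p a b]mul1r; apply: centroid_tangent => //.
    by rewrite ltrDl.
  by rewrite oner_eq0; apply/negbTE.
have cl e : 0 < e -> 1 < centroid p 1 (1 + e).
  by move=> e0; apply: centroid_gt; rewrite ?ltrDl.
have cr e : 0 < e -> centroid p 1 (1 + e) < 1 + e.
  by move=> e0; apply: centroid_lt; rewrite ?ltrDl.
set A := centroid_l p a b in A0 tg *; set B := centroid_r p a b in B0 tg *.
have [p2|p2|p2] := ltgtP p 2; last by rewrite p2 subrr mul0r.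
- rewrite mulr_ge0 ?subr_ge0 ?(ltW p2)// leNgt; apply/negP => d0.
  (* with e equal to the defect 1 - A - B, A + (1 + e) B <= 1 since B < 1 *)
  have e0 : 0 < 1 - A - B by lra.
  move: (tg _ e0) (cl _ e0); rewrite pmulr_rge0 ?subr_gt0// => h1 h2.
  have : 0 < (1 - A - B) * (1 - B) by rewrite mulr_gt0//; lra.
  lra.
- rewrite -mulrNN mulr_ge0 ?oppr_ge0 ?subr_le0 ?(ltW p2)// leNgt.
  apply/negP => d0.
  (* with e equal to the excess A + B - 1, A + (1 + e) B >= 1 + e *)
  have e0 : 0 < A + B - 1 by lra.
  move: (tg _ e0) (cr _ e0); rewrite nmulr_rge0 ?subr_lt0// => h1 h2.
  have : 0 < (A + B - 1) * B by rewrite mulr_gt0.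
  lra.
Qed.

(** The linear mean is the centroid of [[0, b - a]] shifted by [a]; for
    [a > 0] the difference is a positive multiple of the expression of
    [bernoulli_powR] at [a / b]. *)
Lemma centroid_chord (a b : R) : 0 <= a -> a < b ->
  0 <= (2 - p) * (centroid p a b - (a + (p - 1) * b) / p).
Proof.
move=> a0 ab; have p0 : 0 < p by rewrite (lt_trans ltr01).
have b0 : 0 < b by rewrite (le_lt_trans a0).
case: (eqVneq a 0) => [aE|an].
  rewrite aE centroid0// add0r mulrAC.
  by rewrite subrr mulr0.
have ap : 0 < a by rewrite lt0r an.
have D := powR_diff_gt0 hp a0 ab.
have -> : centroid p a b - (a + (p - 1) * b) / p =
  a * b `^ (p - 1) / (p * (b `^ (p - 1) - a `^ (p - 1))) *
  ((2 - p) * (a / b) `^ (p - 1) + (p - 1) * (a / b) `^ (p - 2) - 1).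
  rewrite /centroid (powR_pred p (divr_gt0 ap b0)) !powR_div//.
  rewrite !(powR_succ hp) ?ltW//; field.
  by rewrite !gt_eqF ?powR_gt0.
rewrite mulrCA mulr_ge0 ?bernoulli_powR ?divr_gt0//.
by rewrite ltW// divr_gt0 ?mulr_gt0 ?powR_gt0.
Qed.

Lemma centroid_mid (a b : R) : 0 <= a -> a < b ->
  0 <= (2 - p) * ((a + b) / 2 - centroid p a b).
Proof.
move=> a0 ab; have p0 : 0 < p by rewrite (lt_trans ltr01).
have b0 : 0 < b by rewrite (le_lt_trans a0).
case: (eqVneq a 0) => [aE|an].
  rewrite aE centroid0// (_ : _ * _ = (2 - p) ^+ 2 * (b / (2 * p))).
    by rewrite mulr_ge0 ?sqr_ge0// ltW// divr_gt0// mulr_gt0.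
  by field; rewrite gt_eqF.
have ap : 0 < a by rewrite lt0r an.
have D := powR_diff_gt0 hp a0 ab.
have -> : (a + b) / 2 - centroid p a b =
  a `^ p / (2 * p * (b `^ (p - 1) - a `^ (p - 1))) * centroid_defect (b / a).
  rewrite /centroid /centroid_defect !powR_div ?(ltW b0)//.
  rewrite !(powR_succ hp) ?ltW//; field.
  by rewrite !gt_eqF ?powR_gt0.
rewrite mulrCA mulr_ge0//; first by rewrite ltW// divr_gt0 ?mulr_gt0 ?powR_gt0.
by apply: centroid_defect_sign; rewrite ler_pdivlMr// mul1r ltW.
Qed.
End Tangent.

(** * Three-term recurrences with positive coefficients *)

Section Tridiagonal.
Context {R : realType}.
Implicit Types (al be U V W Y : nat -> R) (n k : nat).

(** Indexed so that row [k] couples entries [k], [k+1] and [k+2], with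
    [al k] and [be k] attached to the interval between entries [k] and [k+1]. *)
Definition tridiag al be V k : R :=
  2 * V k.+1 - al k * V k - (be k + al k.+1) * V k.+1 - be k.+1 * V k.+2.

Lemma tridiagB al be V W c k :
  tridiag al be (fun j => V j - c * W j) k =
  tridiag al be V k - c * tridiag al be W k.
Proof. by rewrite /tridiag; ring. Qed.

(** Maximum principle. Let [c] be the least value of [V / W], attained at
    some entry. If [c < 0] then [Z = V - c W] is nonnegative, has a
    nonnegative image and vanishes at that entry; the row there forces [Z]
    to vanish at the next entry, and so on up to entry [n], where [Z] is
    at least [- c W > 0]. *)
Lemma tridiag_ge0 n al be W V :
  (forall k, (k < n)%N -> 0 <= al k) -> (forall k, (k < n)%N -> 0 < be k) ->
  0 <= W 0%N -> (forall k, (0 < k <= n)%N -> 0 < W k) ->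
  (forall k, (k.+1 < n)%N -> 0 <= tridiag al be W k) ->
  0 <= V 0%N -> 0 <= V n ->
  (forall k, (k.+1 < n)%N -> 0 <= tridiag al be V k) ->
  forall k, (k <= n)%N -> 0 <= V k.
Proof.
move=> al0 be0 W0 Wp LW V0 Vn LV k0 k0n.
case: n => [|n] in al0 be0 Wp LW Vn LV k0n *.
  by move: k0n; rewrite leqn0 => /eqP ->.
pose r (i : 'I_n.+1) := V i.+1 / W i.+1.
case: (@arg_minP _ _ _ ord0 xpredT r isT) => i _ imin.
set c := r i in imin.
have Wpi (j : 'I_n.+1) : 0 < W j.+1 by apply: Wp => /=.
have [c0|c0] := leP 0 c.
  case: k0 k0n => // k kn; have := imin (Ordinal kn) isT; rewrite /r /= => h.
  have W1 := Wpi (Ordinal kn).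
  by rewrite -(divfK (lt0r_neq0 W1) (V _)) mulr_ge0 ?(ltW W1)// (le_trans c0).
pose Z j := V j - c * W j.
have Z0 j : (j <= n.+1)%N -> 0 <= Z j.
  case: j => [_|j jn].
    by rewrite /Z subr_ge0 (le_trans _ V0)// nmulr_rle0.
  have W1 := Wpi (Ordinal jn); have := imin (Ordinal jn) isT.
  by rewrite /Z subr_ge0 /r /= ler_pdivlMr.
have Zi m : (i.+1 + m <= n.+1)%N -> Z (i.+1 + m)%N = 0.
  elim: m => [_|m IH im].
    by rewrite addn0 /Z /c /r divfK ?subrr// gt_eqF.
  have {}IH : Z (i.+1 + m)%N = 0 by apply: IH; rewrite addnS in im; apply: ltnW.
  have kn : ((i + m).+1 < n.+1)%N by rewrite addnS addSn in im.
  have : 0 <= tridiag al be Z (i + m).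
    rewrite tridiagB subr_ge0 (le_trans _ (LV _ kn))//.
    by apply: mulr_le0_ge0; [exact: ltW|exact: LW].
  rewrite /tridiag -!addSn IH !mulr0 subr0 add0r -opprD oppr_ge0 => h.
  have a0 : 0 <= al (i + m)%N * Z (i + m)%N.
    by rewrite mulr_ge0 ?al0 ?Z0//; [exact: ltnW|apply/ltnW/ltnW].
  have Zk : 0 <= Z (i.+2 + m)%N by apply: Z0; rewrite addSnnS.
  have b0 := be0 _ kn; rewrite -addSn in b0.
  have : be (i.+1 + m)%N * Z (i.+2 + m)%N <= 0 by lra.
  rewrite pmulr_rle0// => Zk'; apply/eqP.
  by rewrite -addSnnS eq_le Zk Zk'.
have := Zi (n - i)%N; rewrite addSn subnKC -1?ltnS// => /(_ (leqnn _)).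
move=> /eqP; rewrite /Z subr_eq0 => /eqP VE.
by move: Vn; rewrite VE leNgt nmulr_rlt0// Wp/= ?leqnn.
Qed.

Lemma tridiag_diff al be Y k : tridiag al be Y k = 0 ->
  be k.+1 * (Y k.+2 - Y k.+1) = al k * (Y k.+1 - Y k)
    + (2 - (al k + be k) - (al k.+1 + be k.+1)) * Y k.+1.
Proof. by rewrite /tridiag => h; lra. Qed.

(** When the coefficients of each interval sum to at most 1, [tridiag_diff]
    bounds each difference below by a positive multiple of the previous one. *)
Lemma tridiag_increasing n al be Y :
  (forall k, (k < n)%N -> 0 < al k) -> (forall k, (k < n)%N -> 0 < be k) ->
  (forall k, (k < n)%N -> al k + be k <= 1) ->
  (forall k, (k <= n)%N -> 0 <= Y k) -> Y 0%N < Y 1%N ->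
  (forall k, (k.+1 < n)%N -> tridiag al be Y k = 0) ->
  forall k, (k < n)%N -> Y k < Y k.+1.
Proof.
move=> al0 be0 s1 Y0 Y1 LY; elim=> // k IH kn.
have kn' := ltnW kn; have ks := s1 _ kn; have ks' := s1 _ kn'.
have := tridiag_diff (LY _ kn); rewrite -subr_gt0 => E.
rewrite -(pmulr_rgt0 _ (be0 _ kn)) E ltr_wpDr//.
  by rewrite mulr_ge0 ?Y0//; lra.
by rewrite mulr_gt0 ?al0// subr_gt0 IH.
Qed.

(** When they sum to at least 1, each difference is bounded below by a
    positive multiple of the next one. *)
Lemma tridiag_increasing_rev n al be Y :
  (forall k, (k < n)%N -> 0 < al k) -> (forall k, (k < n)%N -> 0 < be k) ->
  (forall k, (k < n)%N -> 1 <= al k + be k) ->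
  (forall k, (k <= n)%N -> 0 <= Y k) -> Y n.-1 < Y n ->
  (forall k, (k.+1 < n)%N -> tridiag al be Y k = 0) ->
  forall k, (k < n)%N -> Y k < Y k.+1.
Proof.
move=> al0 be0 s1 Y0 Y1 LY k kn.
have [m km] : exists m, (k + m.+1 = n)%N.
  by exists (n - k.+1)%N; rewrite addnS -addSn subnKC.
elim: m k kn km => [|m IH] k kn km.
  by move: Y1; rewrite -km addn1.
have kn' : (k.+1 < n)%N by rewrite -km !addnS !ltnS leq_addr.
have IHk := IH _ kn' (etrans (addSnnS _ _) km).
have ks := s1 _ kn; have ks' := s1 _ kn'.
have E := tridiag_diff (LY _ kn').
rewrite -subr_gt0 -(pmulr_rgt0 _ (al0 _ kn)).
have : 0 < be k.+1 * (Y k.+2 - Y k.+1) by rewrite mulr_gt0 ?be0 ?subr_gt0.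
have : 0 <= (al k + be k + (al k.+1 + be k.+1) - 2) * Y k.+1.
  by rewrite mulr_ge0 ?Y0//; lra.
lra.
Qed.

End Tridiagonal.

(** * Knots *)

Section Knots.
Context {R : realType}.
Implicit Types (l u : R) (n k : nat).

Lemma knot_ord l u n (x : 'cV[R]_n.-1) (i : 'I_n.-1) :
  knot l u x i.+1 = x i 0.
Proof. by rewrite /knot insubT//= => h; congr (x _ _); apply: val_inj. Qed.

Lemma knot_last l u n (x : 'cV[R]_n.-1) : (0 < n)%N -> knot l u x n = u.
Proof. by case: n x => // n x _; rewrite /knot insubF//= ltnn. Qed.

(** [knot 0 0] extends a variation by zero at the two fixed end knots. *)
Lemma knot_sub l u n (x y : 'cV[R]_n.-1) k :
  knot l u x k - knot l u y k = knot 0 0 (x - y) k.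
Proof.
case: k => [|k]; rewrite /knot ?subrr//.
by case: insubP => [i _ _|_] /=; rewrite ?mxE// subrr.
Qed.

Lemma knot_scale l u n (x v : 'cV[R]_n.-1) (h : R) k :
  knot l u (h *: v + x) k = knot l u x k + h * knot 0 0 v k.
Proof.
case: k => [|k]; rewrite /knot ?mulr0 ?addr0//.
by case: insubP => [i _ _|_] /=; rewrite ?mxE ?mulr0 ?addr0// addrC.
Qed.

Lemma knot_delta n (v : 'cV[R]_n.-1) k :
  \sum_j knot 0 0 (delta_mx j 0 : 'cV[R]_n.-1) k * v j 0 = knot 0 0 v k.
Proof.
case: k => [|k]; first by rewrite big1// => j _; rewrite mul0r.
rewrite /knot; case: insubP => [i _ _|_] /=; last first.
  by rewrite big1// => j _; rewrite mul0r.
rewrite (bigD1 i)//= mxE !eqxx mul1r big1 ?addr0// => j ji.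
by rewrite mxE eq_sym (negbTE ji) mul0r.
Qed.

Lemma knot_gt0 l u n (x : 'cV[R]_n.-1) k : 0 <= l -> ordered_knots l u x ->
  (0 < k <= n)%N -> 0 < knot l u x k.
Proof.
move=> l0 ox /andP[]; case: k => // k _ kn.
suff : l < knot l u x k.+1 by apply: le_lt_trans.
elim: k kn => [|k IH] kn; first exact: (ox 0%N).
by rewrite (lt_trans (IH (ltnW kn)))// ox.
Qed.

Lemma knot_ge0 l u n (x : 'cV[R]_n.-1) k : 0 <= l -> ordered_knots l u x ->
  (k <= n)%N -> 0 <= knot l u x k.
Proof. by move=> l0 ox; case: k => // k kn; rewrite ltW// knot_gt0. Qed.

End Knots.

(** * The map F and its Jacobian matrix *)

Section Jacobian.
Context {R : realType} (l u p : R) (n : nat).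
Hypotheses (hl : 0 <= l) (hn : (2 <= n)%N) (hp : 1 < p).
Implicit Types (x y v : 'cV[R]_n.-1) (i j : 'I_n.-1).

(** Up to the factor [p], row [k] of the Jacobian matrix at the knots [X],
    applied to [V]; the end knots count as variables too, so that Euler's
    identity applies. *)
Definition newton_row (X V : nat -> R) (k : nat) : R :=
  tridiag (fun m => centroid_l p (X m) (X m.+1))
    (fun m => centroid_r p (X m) (X m.+1)) V k.

Lemma ord_lt i : (i.+1 < n)%N.
Proof. by have := ltn_ord i; rewrite -ltnS prednK// (ltn_trans _ hn). Qed.

Lemma F_centroid x i (X := knot l u x) :
  0 <= X i -> X i < X i.+1 -> X i.+1 < X i.+2 ->
  F l u p x i 0 =
    p * (2 * X i.+1 - centroid p (X i) (X i.+1) - centroid p (X i.+1) (X i.+2)).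
Proof.
move=> x0 x01 x12; rewrite mxE/= -/(X _) -/(X i.+1) -/(X i.+2).
have x10 : 0 <= X i.+1 by rewrite (le_trans x0)// ltW.
by rewrite FtermE_l ?powR_neq// FtermE_r ?powR_neq//; ring.
Qed.

(** Euler's identity. *)
Lemma F_newton_row x i : ordered_knots l u x ->
  F l u p x i 0 = p * newton_row (knot l u x) (knot l u x) i.
Proof.
move=> ox; have i1n := ord_lt i; have i_n := ltnW i1n.
have x0 : 0 <= knot l u x i by rewrite knot_ge0// ltnW.
have x1 : 0 <= knot l u x i.+1 by rewrite knot_ge0// ltnW.
have x01 := ox _ i_n; have x12 := ox _ i1n.
rewrite F_centroid// /newton_row /tridiag.
rewrite -(centroid_euler hp x0 x01) -(centroid_euler hp x1 x12); ring.
Qed.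

Lemma derive_line (f : 'cV[R]_n.-1 -> R^o) x v :
  'D_v f x = 'D_1 (fun h : R => f (h *: v + x)) 0.
Proof.
rewrite /derive.
have -> : (fun h : R => h^-1 *: ((f \o shift x) (h *: v) - f x)) =
  (fun h : R => h^-1 *: (((fun h : R => f (h *: v + x)) \o shift 0) (h *: 1)
                         - f (0 *: v + x))).
  apply/funext => h /=; rewrite /shift /= addr0 scale0r add0r.
  by rewrite [h *: 1]mulr1.
by [].
Qed.

(** [centroid_l] occurs multiplied by the variation of the left knot; for
    the interval starting at [xi_0 = l] this variation is zero, so its
    conventional value at [l = 0] is harmless. *)
Lemma derive_F x v i : ordered_knots l u x ->
  'D_v (fun y : 'cV[R]_n.-1 => F l u p y i 0 : R^o) x =
    p * newton_row (knot l u x) (knot 0 0 v) i :> R.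
Proof.
move=> ox; rewrite derive_line.
set X := knot l u x; set V := knot 0 0 v.
have i1n := ord_lt i; have i_n := ltnW i1n.
have aff (k : nat) : is_derive (0 : R) 1 (fun h : R => X k + h * V k) (V k).
  have := is_deriveD (is_derive_const (X k) 0)
    (is_derive_mul (is_derive_var 0) (is_derive_const (V k) 0)).
  by move=> /is_derive_congr; apply; rewrite mulr0 mulr1 !add0r.
pose G (h : R) := p * (2 * (X i.+1 + h * V i.+1)
  - centroid p (X i + h * V i) (X i.+1 + h * V i.+1)
  - centroid p (X i.+1 + h * V i.+1) (X i.+2 + h * V i.+2)).
have near_lt (a b c d : R) : a < c ->
    \forall h \near (0 : R), a + h * b < c + h * d.
  move=> ac; have cv : (c + h * d) - (a + h * b) @[h --> (0 : R)] -->
      (c + 0 * d) - (a + 0 * b).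
    by apply: cvgB; apply: cvgD; [exact: cvg_cst| |exact: cvg_cst|];
      apply: cvgM; [exact: cvg_id|exact: cvg_cst|exact: cvg_id|exact: cvg_cst].
  have /(cvgr_gt _ cv) : 0 < (c + 0 * d) - (a + 0 * b).
    by rewrite !mul0r !addr0 subr_gt0.
  by apply: filterS => h; rewrite subr_gt0.
(* the end knot does not move, the other knots are positive at h = 0 *)
have near_ge : \forall h \near (0 : R), 0 <= X i + h * V i.
  case: (nat_of_ord i) i_n => [_|k kn].
    by near=> h; rewrite /X /V /= mulr0 addr0.
  have Xk : 0 < X k.+1 by apply: knot_gt0 => //=; exact: ltnW.
  have := near_lt 0 0 (X k.+1) (V k.+1) Xk; apply: filterS => h.
  by rewrite mulr0 addr0 => /ltW.
have nearG : \forall h \near (0 : R), G h = F l u p (h *: v + x) i 0.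
  have := near_lt _ (V i) _ (V i.+1) (ox _ i_n).
  have := near_lt _ (V i.+1) _ (V i.+2) (ox _ i1n).
  apply: filterS3 near_ge => h h0 h2 h1.
  by rewrite F_centroid !knot_scale.
have dG : is_derive (0 : R) 1 G (p * newton_row X V i).
  have X00 (k : nat) : (k <= n)%N -> 0 <= X k + 0 * V k.
    by move=> kn; rewrite mul0r addr0 knot_ge0.
  have Xlt (k : nat) : (k < n)%N -> X k + 0 * V k < X k.+1 + 0 * V k.+1.
    by move=> kn; rewrite !mul0r !addr0 ox.
  have Xc (k : nat) : (k <= n)%N ->
      0 < X k + 0 * V k \/ (fun h => X k + h * V k) = cst 0.
    case: k => [_|k kn]; last by left; rewrite mul0r addr0 knot_gt0.
    case: (eqVneq l 0) => [l0|l0]; last first.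
      by left; rewrite mul0r addr0 lt0r l0 hl.
    by right; apply/funext => h; rewrite /X /V /= l0 mulr0 addr0.
  have d0 := @is_derive_centroid _ _ hp (fun h => X i + h * V i)
    (fun h => X i.+1 + h * V i.+1) 0 _ _ (X00 _ (ltnW i_n)) (Xlt _ i_n)
    (Xc _ (ltnW i_n)) (aff i) (aff i.+1).
  have d1 := @is_derive_centroid _ _ hp (fun h => X i.+1 + h * V i.+1)
    (fun h => X i.+2 + h * V i.+2) 0 _ _ (X00 _ i_n) (Xlt _ i1n)
    (Xc _ i_n) (aff i.+1) (aff i.+2).
  have := is_derive_mull (is_derive_sub
    (is_derive_sub (is_derive_mull (aff i.+1) 2) d0) d1) p.
  move=> /is_derive_congr; apply.
  by rewrite /newton_row /tridiag !mul0r !addr0; ring.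
by have [_ <-] := near_eq_is_derive nearG dG.
Unshelve. all: by end_near. Qed.

Lemma F'_mulmx x v i : ordered_knots l u x ->
  (F' l u p x *m v) i 0 = p * newton_row (knot l u x) (knot 0 0 v) i.
Proof.
move=> ox; rewrite mxE.
under eq_bigr => j _ do rewrite mxE derive_F//.
rewrite /newton_row /tridiag -!(knot_delta v).
rewrite !mulr_sumr -!sumrB mulr_sumr; apply: eq_bigr => j _; ring.
Qed.
End Jacobian.

(** * One Newton step *)

Section Step.
Context {R : realType} (l u p : R) (n : nat).
Hypotheses (hl : 0 <= l) (hlu : l < u) (hn : (2 <= n)%N).
Hypotheses (hp : 1 < p) (hp2 : p != 2).
Implicit Types (x y v : 'cV[R]_n.-1) (i : 'I_n.-1) (k m : nat).

(** The invariant of the iteration. *)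
Definition signed_iterate x : Prop :=
  ordered_knots l u x /\ forall i, 0 <= (2 - p) * F l u p x i 0.

Let p0 : 0 < p. Proof. exact: lt_trans ltr01 hp. Qed.
Let n0 : (0 < n)%N. Proof. exact: ltnW. Qed.
Let ltn1 k : (k.+1 < n)%N -> (k < n.-1)%N.
Proof. by move=> kn; rewrite -ltnS prednK. Qed.

Lemma newton_rowB (X V W : nat -> R) (c : R) k :
  newton_row p X (fun j => V j - c * W j) k =
  newton_row p X V k - c * newton_row p X W k.
Proof. exact: tridiagB. Qed.

Lemma p_cases : p < 2 \/ 2 < p.
Proof. by case: (ltgtP p 2) hp2 => // h _; [left|right]. Qed.

Lemma knot_centroid_l_gt0 x k : ordered_knots l u x -> (k < n)%N ->
  0 < centroid_l p (knot l u x k) (knot l u x k.+1).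
Proof.
move=> ox kn; apply: centroid_l_gt0 => //; last exact: ox.
by apply: knot_ge0 => //; exact: ltnW.
Qed.

Lemma knot_centroid_r_gt0 x k : ordered_knots l u x -> (k < n)%N ->
  0 < centroid_r p (knot l u x k) (knot l u x k.+1).
Proof.
move=> ox kn; apply: centroid_r_gt0 => //; last exact: ox.
by apply: knot_ge0 => //; exact: ltnW.
Qed.

Lemma knot_centroid_lDr x k : ordered_knots l u x -> (k < n)%N ->
  0 <= (2 - p) * (centroid_l p (knot l u x k) (knot l u x k.+1)
                  + centroid_r p (knot l u x k) (knot l u x k.+1) - 1).
Proof.
move=> ox kn; apply: centroid_lDr => //; last exact: ox.
by apply: knot_ge0 => //; exact: ltnW.
Qed.

Lemma newton_row_sign x k : signed_iterate x -> (k.+1 < n)%N ->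
  0 <= (2 - p) * newton_row p (knot l u x) (knot l u x) k.
Proof.
move=> [ox Fx] kn; have := Fx (Ordinal (ltn1 kn)).
by rewrite F_newton_row// mulrCA pmulr_rge0.
Qed.

(** The supersolution of the maximum principle is the knot vector itself
    when [p < 2], since [F >= 0] there, and the constant 1 when [p > 2],
    since then the coefficients of each interval sum to at most 1. *)
Lemma newton_row_ge0 x (V : nat -> R) : signed_iterate x ->
  0 <= V 0%N -> 0 <= V n ->
  (forall k, (k.+1 < n)%N -> 0 <= newton_row p (knot l u x) V k) ->
  forall k, (k <= n)%N -> 0 <= V k.
Proof.
move=> sx V0 Vn LV; have [ox Fx] := sx.
have [p2|p2] := p_cases.
- apply: (tridiag_ge0 (W := knot l u x)) LV => //.
  + by move=> k kn; rewrite ltW// knot_centroid_l_gt0.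
  + by move=> k kn; rewrite knot_centroid_r_gt0.
  + by move=> k kn; rewrite knot_gt0.
  + by move=> k kn; have := newton_row_sign sx kn; rewrite pmulr_rge0 ?subr_gt0.
- apply: (tridiag_ge0 (W := fun=> 1)) LV => //.
  + by move=> k kn; rewrite ltW// knot_centroid_l_gt0.
  + by move=> k kn; rewrite knot_centroid_r_gt0.
  + move=> k kn; have := knot_centroid_lDr ox kn.
    have := knot_centroid_lDr ox (ltnW kn).
    rewrite !nmulr_rge0 ?subr_lt0// /tridiag; lra.
Qed.

(** A vector of the kernel, extended by zero, is nonnegative by the maximum
    principle, and so is its opposite; hence it is zero. *)
Lemma F'_unit x : signed_iterate x -> F' l u p x \in unitmx.
Proof.
move=> sx; have [ox _] := sx.
rewrite -unitmx_tr -row_free_unit; apply: inj_row_free => v h.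
have {}h : F' l u p x *m v^T = 0 by rewrite -[LHS]trmxK trmx_mul trmxK h trmx0.
have L0 k : (k.+1 < n)%N -> newton_row p (knot l u x) (knot 0 0 v^T) k = 0.
  move=> kn; have := F'_mulmx hl hn hp v^T (Ordinal (ltn1 kn)) ox.
  by rewrite h mxE => /esym/eqP; rewrite mulf_eq0 (gt_eqF p0) => /eqP.
have V0 : knot 0 0 v^T 0%N = 0 by [].
have Vn : knot 0 0 v^T n = 0 by rewrite knot_last.
have Vge k : (k <= n)%N -> 0 <= knot 0 0 v^T k.
  by apply: (newton_row_ge0 sx) => [||j jn]; rewrite ?V0 ?Vn ?L0.
have Vle k : (k <= n)%N -> 0 <= 0 - 1 * knot 0 0 v^T k.
  apply: (newton_row_ge0 (V := fun k => 0 - 1 * knot 0 0 v^T k) sx) => [||j jn].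
  - by rewrite V0 mulr0 subr0.
  - by rewrite Vn mulr0 subr0.
  - rewrite (newton_rowB _ (fun=> 0)) L0// /newton_row /tridiag; lra.
apply: trmx_inj; apply/colP => i; rewrite trmx0 [RHS]mxE.
rewrite -(knot_ord 0 0 v^T i); apply/eqP; rewrite eq_le.
have := Vge _ (ltnW (ord_lt hn i)); have := Vle _ (ltnW (ord_lt hn i)).
by rewrite mul1r sub0r oppr_ge0 => -> ->.
Qed.

(** The Newton equation [F + F' (y - x) = 0], with [F] written as [F' x] by
    Euler's identity, leaves [F' y = 0] for the extended vector of new
    knots. *)
Lemma newton_step_row x k : signed_iterate x -> (k.+1 < n)%N ->
  newton_row p (knot l u x) (knot l u (newton_step l u p x)) k = 0.
Proof.
move=> sx kn; have [ox _] := sx; set y := newton_step l u p x.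
pose i := Ordinal (ltn1 kn).
have : F' l u p x *m (x - y) = F l u p x.
  by rewrite /y /newton_step opprB addrCA subrr addr0 mulKVmx// F'_unit.
move=> /colP /(_ i); rewrite F'_mulmx// F_newton_row//.
move=> /(mulfI (lt0r_neq0 p0)) /= E.
have -> : knot l u y = (fun j => knot l u x j - 1 * knot 0 0 (x - y) j).
  by apply/funext => j; rewrite mul1r -(knot_sub l u); ring.
by rewrite newton_rowB E mul1r subrr.
Qed.

Lemma newton_step_sign x : signed_iterate x ->
  forall k, (k <= n)%N ->
    0 <= (2 - p) * (knot l u x k - knot l u (newton_step l u p x) k).
Proof.
move=> sx; set y := newton_step l u p x.
have Ly k (kn : (k.+1 < n)%N) : newton_row p (knot l u x) (knot l u y) k = 0.
  exact: newton_step_row.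
apply: (newton_row_ge0
  (V := fun k => (2 - p) * (knot l u x k - knot l u y k)) sx).
- by rewrite subrr mulr0.
- by rewrite !knot_last// subrr mulr0.
- move=> k kn.
  suff -> : newton_row p (knot l u x)
        (fun k => (2 - p) * (knot l u x k - knot l u y k)) k =
      (2 - p) * newton_row p (knot l u x) (knot l u x) k.
    exact: newton_row_sign.
  rewrite -[in RHS](subr0 (newton_row _ _ _ _)) -(Ly k kn).
  by rewrite /newton_row /tridiag; ring.
Qed.

(** The knots move away from one end, the right one when they decrease and
    the left one when they increase, so the outermost interval there keeps a
    positive length; the recurrence propagates this to the other intervals. *)
Lemma newton_step_ordered x : signed_iterate x ->
  ordered_knots l u (newton_step l u p x).
Proof.
move=> sx; have [ox _] := sx; set y := newton_step l u p x.
have Ly k (kn : (k.+1 < n)%N) : newton_row p (knot l u x) (knot l u y) k = 0.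
  exact: newton_step_row.
have y0 k : (k <= n)%N -> 0 <= knot l u y k.
  apply: (newton_row_ge0 sx) => //.
    by rewrite knot_last// (le_trans hl)// ltW.
  by move=> j jn; rewrite Ly.
have [p2|p2] := p_cases.
- apply: (tridiag_increasing_rev _ _ _ y0 _ Ly).
  + by move=> k kn; apply: knot_centroid_l_gt0.
  + by move=> k kn; apply: knot_centroid_r_gt0.
  + move=> k kn; have := knot_centroid_lDr ox kn.
    by rewrite pmulr_rge0 ?subr_gt0// subr_ge0.
  + have := newton_step_sign sx (leq_pred n).
    rewrite pmulr_rge0 ?subr_gt0// subr_ge0 -/y => /le_lt_trans; apply.
    have : (n.-1 < n)%N by rewrite prednK.
    by move/ox; rewrite prednK// !knot_last.
- apply: (tridiag_increasing _ _ _ y0 _ Ly).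
  + by move=> k kn; apply: knot_centroid_l_gt0.
  + by move=> k kn; apply: knot_centroid_r_gt0.
  + move=> k kn; have := knot_centroid_lDr ox kn.
    by rewrite nmulr_rge0 ?subr_lt0// subr_le0.
  + have := newton_step_sign sx n0.
    rewrite nmulr_rge0 ?subr_lt0// subr_le0 -/y; apply: lt_le_trans.
    exact: (ox 0%N).
Qed.

(** The tangent inequality compares [F] at the new knots with its
    linearization at the old ones, which vanishes there. *)
Lemma newton_step_signed x : signed_iterate x ->
  signed_iterate (newton_step l u p x).
Proof.
move=> sx; have [ox _] := sx; set y := newton_step l u p x.
have oy : ordered_knots l u y by apply: newton_step_ordered.
split=> // i; have i1n := ord_lt hn i; have i_n := ltnW i1n.
have tg k : (k < n)%N -> 0 <= (2 - p) *
    (knot l u y k * centroid_l p (knot l u x k) (knot l u x k.+1) +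
     knot l u y k.+1 * centroid_r p (knot l u x k) (knot l u x k.+1) -
     centroid p (knot l u y k) (knot l u y k.+1)).
  move=> kn; have kn' := ltnW kn.
  apply: centroid_tangent; rewrite ?knot_ge0 ?ox ?oy//.
  case: k kn kn' => // k kn kn'.
  by rewrite !gt_eqF// knot_gt0.
have L0 := newton_step_row sx i1n.
rewrite F_centroid ?knot_ge0 ?oy// ?(ltnW i_n)// mulrCA pmulr_rge0//.
have := tg _ i_n; have := tg _ i1n; move: L0; rewrite /newton_row /tridiag -/y.
set al := centroid_l; set be := centroid_r; set c := centroid => E h1 h2.
have : 0 <= (2 - p) * 0 by rewrite mulr0.
rewrite -{2}E; lra.
Qed.

Lemma newton_initE k : (k <= n)%N ->
  knot l u (newton_init l u n) k = l + k%:R * (u - l) / n%:R.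
Proof.
move=> kn; have nn : n%:R != 0 :> R by rewrite pnatr_eq0 -lt0n.
case: (ltnP k n) => [{}kn|nk]; last first.
  have -> : k = n by apply/eqP; rewrite eqn_leq kn.
  by rewrite knot_last// mulrAC divff// mul1r addrC subrK.
case: k kn => [|k] kn; first by rewrite mul0r mul0r addr0.
by rewrite (knot_ord l u _ (Ordinal (ltn1 kn))) mxE.
Qed.

(** On the uniform grid every knot is the average of the midpoints of its
    two intervals, and [centroid_mid] tells on which side of each midpoint
    the centroid lies. *)
Lemma newton_init_signed : signed_iterate (newton_init l u n).
Proof.
set h := (u - l) / n%:R.
have h0 : 0 < h by rewrite divr_gt0 ?subr_gt0// ltr0n.
have E k : (k <= n)%N -> knot l u (newton_init l u n) k = l + k%:R * h.
  by move=> kn; rewrite newton_initE// -mulrA.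
have o : ordered_knots l u (newton_init l u n).
  move=> k kn; rewrite !E// ?(ltnW kn)// -natr1 mulrDl mul1r; lra.
split=> // i; have i1n := ord_lt hn i; have i_n := ltnW i1n.
rewrite F_centroid ?knot_ge0 ?o// ?(ltnW i_n)// mulrCA pmulr_rge0//.
have := centroid_mid hp (knot_ge0 hl o (ltnW i_n)) (o _ i_n).
have := centroid_mid hp (knot_ge0 hl o i_n) (o _ i1n).
set c1 := centroid _ _ _; set c2 := centroid _ _ _.
have : knot l u (newton_init l u n) i + knot l u (newton_init l u n) i.+2 =
  2 * knot l u (newton_init l u n) i.+1.
  by rewrite !E// ?(ltnW i_n)// -!natr1; ring.
set a := knot _ _ _ i; set b := knot _ _ _ i.+1; set d := knot _ _ _ i.+2.
move=> E1; rewrite -E1 => h1 h2.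
have -> : a + d - c2 - c1 =
  ((a + b) / 2 - c2) + ((b + d) / 2 - c1) + ((a + d) / 2 - b) by field.
by rewrite E1 mulrAC divff// mul1r subrr addr0 mulrDr addr_ge0.
Qed.

Lemma newton_signed k : signed_iterate (newton l u p n k).
Proof.
elim: k => [|k IH]; first exact: newton_init_signed.
exact: newton_step_signed.
Qed.

(** The sign of [F] after replacement of the centroids by the linear means
    of [centroid_chord]. Unlike the centroids, these also make sense on
    collapsed intervals, so the inequality survives in the limit. *)
Lemma knot_gap_sign x k : signed_iterate x -> (k.+1 < n)%N ->
  0 <= (2 - p) * ((knot l u x k.+1 - knot l u x k)
                  - (p - 1) * (knot l u x k.+2 - knot l u x k.+1)).
Proof.
move=> [ox Fx] kn; have := Fx (Ordinal (ltn1 kn)).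
have k1n := ltnW kn; have k_n := ltnW k1n.
rewrite F_centroid ?knot_ge0 ?ox//= mulrCA pmulr_rge0//.
have := centroid_chord hp (knot_ge0 hl ox k_n) (ox _ k1n).
have := centroid_chord hp (knot_ge0 hl ox k1n) (ox _ kn).
set c1 := centroid _ _ _; set c2 := centroid _ _ _.
set a := knot _ _ _ k; set b := knot _ _ _ k.+1; set d := knot _ _ _ k.+2.
move=> h1 h2 h3; have -> : (2 - p) * (b - a - (p - 1) * (d - b)) =
  p * ((2 - p) * (c2 - (a + (p - 1) * b) / p)
       + (2 - p) * (c1 - (b + (p - 1) * d) / p)
       + (2 - p) * (2 * b - c2 - c1)) by field; rewrite gt_eqF.
by rewrite mulr_ge0 ?(ltW p0)// !addr_ge0.
Qed.

End Step.

(** * Convergence *)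

Lemma cvg_col {R : realType} (n : nat) (x_ : nat -> 'cV[R]_n) (a : 'cV[R]_n) :
  (forall i, x_ k i 0 @[k --> \oo] --> a i 0) -> x_ @ \oo --> a.
Proof.
move=> xa; apply/cvg_mx_entourageP => A entA.
apply: filter_forall => i; apply: filter_forall => j; rewrite (ord1 j).
have H := iffLR (cvg_entourageP _ _) (xa i) A entA.
have {}H : \forall k \near \oo, A (a i 0, x_ k i 0) by exact: (H _).
suff : \forall k \near \oo, (a i 0, x_ k i 0) \in A by [].
by apply: filterS H => k /=; rewrite inE.
Qed.

Lemma cvg_powR {R : realType} (a_ : nat -> R) (a r : R) : 0 < a ->
  a_ @ \oo --> a -> a_ k `^ r @[k --> \oo] --> a `^ r.
Proof.
move=> a0 aa; apply: (@continuous_cvg _ _ _ _ _ a_ (fun y => y `^ r)) => //.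
apply: differentiable_continuous; apply/derivable1_diffP.
by have [] := is_derive1_powR r a0.
Qed.

Section Limit.
Context {R : realType} (l u p : R) (n : nat).
Hypotheses (hl : 0 <= l) (hp : 1 < p).
Variables (x_ : nat -> 'cV[R]_n.-1) (a : 'cV[R]_n.-1).
Hypotheses (ox : forall k, ordered_knots l u (x_ k)) (oa : ordered_knots l u a).
Hypothesis xa : forall i, x_ k i 0 @[k --> \oo] --> a i 0.

Lemma cvg_knot m : knot l u (x_ k) m @[k --> \oo] --> knot l u a m.
Proof.
case: m => [|m]; first exact: cvg_cst.
rewrite /knot; case: insubP => [i _ _|_] /=; [exact: xa|exact: cvg_cst].
Qed.

(** The zeroth knot may be 0, where real powers need not be continuous, but
    it is constant along the sequence. *)
Lemma cvg_knot_powR m r : (m <= n)%N ->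
  knot l u (x_ k) m `^ r @[k --> \oo] --> knot l u a m `^ r.
Proof.
case: m => [_|m mn]; first by rewrite /=; exact: cvg_cst.
by apply: cvg_powR; [apply: knot_gt0|apply: cvg_knot].
Qed.

Lemma cvg_knot_diff m : (m < n)%N ->
  (knot l u (x_ k) m.+1 `^ (p - 1) - knot l u (x_ k) m `^ (p - 1))^-1
    @[k --> \oo] -->
  (knot l u a m.+1 `^ (p - 1) - knot l u a m `^ (p - 1))^-1.
Proof.
move=> mn; apply: cvgV.
  by rewrite gt_eqF// powR_diff_gt0 ?oa// knot_ge0// ltnW.
by apply: cvgB; apply: cvg_knot_powR => //; exact: ltnW.
Qed.

Lemma cvg_centroid m : (m < n)%N ->
  centroid p (knot l u (x_ k) m) (knot l u (x_ k) m.+1) @[k --> \oo] -->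
  centroid p (knot l u a m) (knot l u a m.+1).
Proof.
move=> mn; apply: cvgM; first exact: cvg_cst.
apply: cvgM; last exact: cvg_knot_diff.
by apply: cvgB; apply: cvg_knot_powR => //; exact: ltnW.
Qed.

Lemma cvg_centroid_r m : (m < n)%N ->
  centroid_r p (knot l u (x_ k) m) (knot l u (x_ k) m.+1) @[k --> \oo] -->
  centroid_r p (knot l u a m) (knot l u a m.+1).
Proof.
move=> mn; apply: cvgM; last exact: cvg_knot_diff.
apply: cvgM.
  by apply: cvgM; [exact: cvg_cst|exact: cvg_knot_powR].
by apply: cvgB; [exact: cvg_knot|exact: cvg_centroid].
Qed.

Lemma cvg_centroid_l m : (m < n)%N ->
  centroid_l p (knot l u (x_ k) m) (knot l u (x_ k) m.+1) @[k --> \oo] -->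
  centroid_l p (knot l u a m) (knot l u a m.+1).
Proof.
move=> mn; rewrite /centroid_l.
have eq0 k : (knot l u (x_ k) m == 0) = (knot l u a m == 0).
  case: m mn => // m mn.
  by rewrite !gt_eqF//; apply: knot_gt0 => //=; exact: ltnW.
under eq_fun do rewrite eq0.
case: ifP => _; first exact: cvg_cst.
apply: cvgM; last exact: cvg_knot_diff.
apply: cvgM.
  by apply: cvgM; [exact: cvg_cst|apply: cvg_knot_powR; exact: ltnW].
by apply: cvgB; [exact: cvg_centroid|exact: cvg_knot].
Qed.

Lemma cvg_newton_row m : (m.+1 < n)%N ->
  newton_row p (knot l u (x_ k)) (knot l u (x_ k.+1)) m @[k --> \oo] -->
  newton_row p (knot l u a) (knot l u a) m.
Proof.
move=> mn; have mn' := ltnW mn.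
have sh j : knot l u (x_ k.+1) j @[k --> \oo] --> knot l u a j.
  by rewrite (cvg_shiftS (fun k => knot l u (x_ k) j)); exact: cvg_knot.
rewrite /newton_row /tridiag; apply: cvgB; [apply: cvgB; [apply: cvgB|]|].
- by apply: cvgM; [exact: cvg_cst|exact: sh].
- by apply: cvgM; [exact: cvg_centroid_l|exact: sh].
- apply: cvgM; last exact: sh.
  by apply: cvgD; [exact: cvg_centroid_r|exact: cvg_centroid_l].
- by apply: cvgM; [exact: cvg_centroid_r|exact: sh].
Qed.

End Limit.

Section Convergence.
Context {R : realType} (l u p : R) (n : nat).
Hypotheses (hl : 0 <= l) (hlu : l < u) (hn : (2 <= n)%N).
Hypotheses (hp : 1 < p) (hp2 : p != 2).
Local Notation x_ := (newton l u p n).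
Let sx k : signed_iterate l u p (x_ k). Proof. exact: newton_signed. Qed.

Lemma knot_le_last (x : 'cV[R]_n.-1) m : ordered_knots l u x -> (m <= n)%N ->
  knot l u x m <= u.
Proof.
move=> ox mn; suff H d k : (k + d)%N = n -> knot l u x k <= u.
  by apply: (H (n - m)%N); rewrite subnKC.
elim: d k => [|d IH] k kd.
  by rewrite addn0 in kd; rewrite kd knot_last// ltnW.
have kn : (k < n)%N by rewrite -kd addnS ltnS leq_addr.
by rewrite (le_trans (ltW (ox _ kn)))// IH// addSnnS.
Qed.

Lemma newton_sign k (i : 'I_n.-1) : 0 <= (2 - p) * (x_ k i 0 - x_ k.+1 i 0).
Proof.
have := newton_step_sign hl hn hp hp2 (sx k) (ltnW (ord_lt hn i)).
by rewrite !knot_ord.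
Qed.

Lemma newton_ge0 k (i : 'I_n.-1) : 0 <= x_ k i 0.
Proof.
by rewrite -(knot_ord l u) knot_ge0//; [have [] := sx k|exact/ltnW/ord_lt].
Qed.

Lemma newton_nonincr (i : 'I_n.-1) : p < 2 ->
  nonincreasing_seq (fun k => x_ k i 0).
Proof.
move=> p2; apply/nonincreasing_seqP => k.
by have := newton_sign k i; rewrite pmulr_rge0 ?subr_gt0// subr_ge0.
Qed.

Lemma newton_nondecr (i : 'I_n.-1) : 2 < p ->
  nondecreasing_seq (fun k => x_ k i 0).
Proof.
move=> p2; apply/nondecreasing_seqP => k.
by have := newton_sign k i; rewrite nmulr_rge0 ?subr_lt0// subr_le0.
Qed.

Lemma newton_cvg (i : 'I_n.-1) : cvgn (fun k => x_ k i 0).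
Proof.
have [p2|p2] := p_cases hp2.
- apply: nonincreasing_is_cvgn; first exact: newton_nonincr.
  by exists 0 => _ [k _ <-]; exact: newton_ge0.
- apply: nondecreasing_is_cvgn; first exact: newton_nondecr.
  exists u => _ [k _ <-]; rewrite -(knot_ord l u).
  by apply: knot_le_last; [have [] := sx k|exact/ltnW/ord_lt].
Qed.

Definition newton_lim : 'cV[R]_n.-1 := \col_i limn (fun k => x_ k i 0).

Lemma newton_coord_cvg (i : 'I_n.-1) : x_ k i 0 @[k --> \oo] --> newton_lim i 0.
Proof. by rewrite mxE; exact: newton_cvg. Qed.

Lemma newton_lim_init m : (m <= n)%N ->
  0 <= (2 - p) * (knot l u (x_ 0%N) m - knot l u newton_lim m).
Proof.
move=> mn.
have cv : (2 - p) * (knot l u (x_ 0%N) m - knot l u (x_ k) m) @[k --> \oo] -->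
    (2 - p) * (knot l u (x_ 0%N) m - knot l u newton_lim m).
  apply: cvgM; first exact: cvg_cst.
  apply: cvgB; first exact: cvg_cst.
  exact: (@cvg_knot R l u n _ _ newton_coord_cvg m).
apply: (cvgr_to_ge cv); apply: nearW; elim=> [|k IH].
  by rewrite subrr mulr0.
have := addr_ge0 IH (newton_step_sign hl hn hp hp2 (sx k) mn).
by rewrite -mulrDr addrA subrK.
Qed.

Lemma newton_lim_gap k : (k.+1 < n)%N ->
  0 <= (2 - p) *
    ((knot l u newton_lim k.+1 - knot l u newton_lim k)
     - (p - 1) * (knot l u newton_lim k.+2 - knot l u newton_lim k.+1)).
Proof.
move=> kn; have cv m := @cvg_knot R l u n _ _ newton_coord_cvg m.
have {}cv : (2 - p) * ((knot l u (x_ j) k.+1 - knot l u (x_ j) k)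
      - (p - 1) * (knot l u (x_ j) k.+2 - knot l u (x_ j) k.+1))
      @[j --> \oo] -->
    (2 - p) * ((knot l u newton_lim k.+1 - knot l u newton_lim k)
      - (p - 1) * (knot l u newton_lim k.+2 - knot l u newton_lim k.+1)).
  apply: cvgM; [exact: cvg_cst|apply: cvgB; [exact: cvgB|]].
  by apply: cvgM; [exact: cvg_cst|exact: cvgB].
apply: (cvgr_to_ge cv); apply: nearW => j.
exact: (knot_gap_sign hl hn hp (sx j)).
Qed.

(** One extreme gap of the limit is at least that of the initial grid,
    because the knots move away from that end; [newton_lim_gap] propagates
    its positivity to all other gaps. *)
Lemma newton_lim_ordered : ordered_knots l u newton_lim.
Proof.
have q0 : 0 < p - 1 by rewrite subr_gt0.
have n0 : (0 < n)%N by exact: ltnW.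
have [ox0 _] := sx 0; set a := newton_lim.
have [p2|p2] := p_cases hp2.
- have gap k : (k.+1 < n)%N ->
      (p - 1) * (knot l u a k.+2 - knot l u a k.+1) <=
      knot l u a k.+1 - knot l u a k.
    move=> kn; have := newton_lim_gap kn.
    by rewrite pmulr_rge0 ?subr_gt0// subr_ge0.
  move=> k kn; have [d kd] : exists d, (k + d.+1)%N = n.
    by exists (n - k.+1)%N; rewrite addnS -addSn subnKC.
  elim: d k kd kn => [|d IH] k kd kn.
    have := newton_lim_init (ltnW kn).
    rewrite pmulr_rge0 ?subr_gt0// subr_ge0.
    move=> /le_lt_trans; apply; have := ox0 _ kn.
    by rewrite -addn1 kd !knot_last.
  have kn' : (k.+1 < n)%N by rewrite -kd !addnS !ltnS leq_addr.
  rewrite -subr_gt0 (lt_le_trans _ (gap _ kn'))// mulr_gt0// subr_gt0.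
  by apply: IH => //; rewrite addSnnS.
- have gap k : (k.+1 < n)%N ->
      knot l u a k.+1 - knot l u a k <=
      (p - 1) * (knot l u a k.+2 - knot l u a k.+1).
    move=> kn; have := newton_lim_gap kn.
    by rewrite nmulr_rge0 ?subr_lt0// subr_le0.
  elim=> [|k IH] kn.
    have := newton_lim_init n0; rewrite nmulr_rge0 ?subr_lt0// subr_le0.
    by apply: lt_le_trans; exact: (ox0 0%N).
  rewrite -subr_gt0 -(pmulr_rgt0 _ q0) (lt_le_trans _ (gap _ kn))//.
  by rewrite subr_gt0 IH// ltnW.
Qed.

Lemma newton_lim_root : F l u p newton_lim = 0.
Proof.
apply/colP => i; rewrite F_newton_row//; last exact: newton_lim_ordered.
have ox k : ordered_knots l u (x_ k) by have [] := sx k.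
have cv := cvg_newton_row hl hp ox newton_lim_ordered newton_coord_cvg
  (ord_lt hn i).
have L0 : (fun k => newton_row p (knot l u (x_ k)) (knot l u (x_ k.+1)) i) =
    fun=> 0.
  apply/funext => k; exact: (newton_step_row hl hn hp hp2 (sx k) (ord_lt hn i)).
rewrite L0 in cv; rewrite mxE.
by rewrite (cvg_unique _ cv (cvg_cst 0)) ?mulr0.
Qed.
End Convergence.

Theorem theorem3p13 (R : realType) (l u p : R) (n : nat)
  (hl : 0 <= l) (hlu : l < u) (hn : (2 <= n)%N) (hp1 : 1 < p) (hp2 : p != 2) :
  (* the iterates are well defined *)
  (forall k : nat, ordered_knots l u (newton l u p n k) /\
                   F' l u p (newton l u p n k) \in unitmx) /\
  exists xstar : 'cV[R]_n.-1,
    [/\ ordered_knots l u xstar,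
        F l u p xstar = 0,
        newton l u p n k @[k --> \oo] --> xstar,
        p < 2 -> forall i : 'I_n.-1,
          nonincreasing_seq (fun k => newton l u p n k i 0)
      & 2 < p -> forall i : 'I_n.-1,
          nondecreasing_seq (fun k => newton l u p n k i 0)].
Proof.
split=> [k|].
  have sk := newton_signed hl hlu hn hp1 hp2 k.
  by split; [case: sk|exact: F'_unit].
exists (newton_lim l u p n); split.
- exact: newton_lim_ordered.
- exact: newton_lim_root.
- by apply: cvg_col => i; exact: newton_coord_cvg.
- by move=> p2 i; exact: newton_nonincr.
- by move=> p2 i; exact: newton_nondecr.
Qed.
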